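(* Let $z:(0,\infty)\to[0,\infty)$ be nonincreasing and lower semi-continuous, set $c(\phi)=z(\phi)\phi$ for $\phi>0$, $c(0)=0$, and assume $\int_0^1\sqrt{c(\phi)}\,d\phi<\infty$. Let $\tau^z(w)=\inf\{F^c[\psi]\mid\psi:\mathbb{R}\to[0,\infty),\ \int_{\mathbb{R}}\psi\,dy=w\}$ and suppose that for some $W>0$ we have $\tau^z(w)=(\tau^z)'(0)\,w$ for all $w\in[0,W]$, where $(\tau^z)'(0)$ is the right derivative at $0$. Then for every $w\in(0,W)$ there is no $\psi:\mathbb{R}\to[0,\infty)$ with $\int_{\mathbb{R}}\psi\,dy=w$ and $F^c[\psi]=\tau^z(w)$.
   Context: For $c:[0,\infty)\to[0,\infty)$ and $\psi:\mathbb{R}\to\mathbb{R}$ (with locally integrable weak derivative; otherwise the energy is $+\infty$), $F^c[\psi]=\int_{\mathbb{R}}\frac12|\psi'(y)|^2+c(|\psi(y)|)\,dy$. *)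

(* Defs.v *)
From HB Require Import structures.
From mathcomp Require Import all_boot all_order all_algebra.
From mathcomp Require Import all_classical all_reals all_analysis.
Set Implicit Arguments. Unset Strict Implicit. Unset Printing Implicit Defensive.
Import Order.TTheory GRing.Theory Num.Theory.
Import numFieldNormedType.Exports.
Local Open Scope classical_set_scope.
Local Open Scope ring_scope.

Section Defs.
Variable R : realType.
Local Notation mu := (@lebesgue_measure R).

Definition cz (z : R -> R) (p : R) : R := if 0 < p then z p * p else 0.

Definition lsc_pos (z : R -> R) : Prop :=
  forall x a, 0 < x -> a < z x -> \forall y \near x, a < z y.

Definition test_fun (phi : R -> R) : Prop :=
  (forall n x, derivable (derive1n n phi) x 1) /\
  exists M : R, forall x, M < `|x| -> phi x = 0.

Definition weak_deriv (psi g : R -> R) : Prop :=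
  locally_integrable setT psi /\ locally_integrable setT g /\
  forall phi, test_fun phi ->
    (\int[mu]_x (psi x * derive1 phi x)%:E = - \int[mu]_x (g x * phi x)%:E)%E.

(* F^c[psi] = int 1/2 |psi'|^2 + c(|psi|); +oo if no locally integrable
   weak derivative exists (inf over the empty set is +oo) *)
Definition energy (c : R -> R) (psi : R -> R) : \bar R :=
  ereal_inf [set (\int[mu]_y ((g y) ^+ 2 / 2 + c `|psi y|)%:E)%E
            | g in [set g | weak_deriv psi g]].

Definition admissible (w : R) (psi : R -> R) : Prop :=
  measurable_fun setT psi /\ (forall y, 0 <= psi y) /\
  (\int[mu]_y (psi y)%:E = w%:E)%E.

Definition tau (z : R -> R) (w : R) : \bar R :=
  ereal_inf [set energy (cz z) psi | psi in admissible w].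

End Defs.

(* Main.v *)
(* Dilating a competitor psi(y / l) multiplies its mass and its potential energy
   by l but divides its kinetic energy by l.  If tau is linear on [0, W] and psi is
   a minimizer of mass w < W, comparing psi with its dilation of mass W = l * w
   therefore forces the kinetic energy of psi to vanish.  Hence psi integrates to 0
   against phi' for every test function phi; testing with phi(x / n) for a bump
   phi with phi'(0) <> 0 and letting n tend to infinity gives phi'(0) * w = 0. *)
Require Import Defs.
From HB Require Import structures.
From mathcomp Require Import all_boot all_order all_algebra.
From mathcomp Require Import all_classical all_reals all_analysis.
From mathcomp Require Import measurable_realfun ring lra.
Set Implicit Arguments. Unset Strict Implicit. Unset Printing Implicit Defensive.
Import Order.TTheory GRing.Theory Num.Theory.
Import numFieldNormedType.Exports.
Local Open Scope classical_set_scope.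
Local Open Scope ring_scope.

(** * Closure properties of smooth functions *)

Section smooth.
Context {R : realType}.
Implicit Types (a b c x : R) (f g h : R -> R) (B : (R -> R) -> Prop).

Definition smooth f := forall n x, derivable (derive1n n f) x 1.

(** The linear span of [B]. The families used below are not closed under differentiation, but the
    derivative of each member is a linear combination of members. *)
Inductive fspan B : (R -> R) -> Prop :=
| fspan_base f of B f : fspan B f
| fspanD f g of fspan B f & fspan B g : fspan B (fun x => f x + g x)
| fspanZ c f of fspan B f : fspan B (fun x => c * f x).

Lemma derive1_is_derive f g :
  (forall x : R, is_derive x (1 : R) f (g x)) -> derive1 f = g.
Proof.
by move=> fg; apply/funext => x; rewrite derive1E; apply: derive_val.
Qed.

(* This proves smoothness without a formula for the iterated derivatives. *)
Lemma smooth_fspan B :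
  (forall f, B f ->
    exists2 f', fspan B f' & forall x : R, is_derive x (1 : R) f (f' x)) ->
  forall f, B f -> smooth f.
Proof.
move=> dB.
have dspan f : fspan B f ->
    exists2 f', fspan B f' & forall x : R, is_derive x (1 : R) f (f' x).
  elim=> {f} [f /dB//|f g _ [f' sf' df] _ [g' sg' dg]|c f _ [f' sf' df]].
    exists (fun x => f' x + g' x); first exact: fspanD.
    by move=> x; exact: is_deriveD.
  exists (fun x => c * f' x); first exact: fspanZ.
  by move=> x; exact: is_deriveZ.
move=> f Bf n; have := fspan_base Bf.
elim: n f {Bf} => [f /dspan[f' _ df] x|n IH f /dspan[f' sf' df] x].
  by case: (df x).
by rewrite derive1Sn (derive1_is_derive df); exact: IH.
Qed.

Lemma smooth_is_derive f (x : R) : smooth f -> is_derive x (1 : R) f (derive1 f x).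
Proof. by move=> sf; apply: DeriveDef; [exact: (sf 0%N)|rewrite derive1E]. Qed.

Lemma smooth_derive1 f : smooth f -> smooth (derive1 f).
Proof. by move=> sf n x; have := sf n.+1 x; rewrite derive1Sn. Qed.

Lemma smooth_continuous f : smooth f -> continuous f.
Proof.
by move=> sf x; exact/differentiable_continuous/derivable1_diffP/(sf 0%N).
Qed.

Lemma is_derive_affine f (a b x df : R) : is_derive (a * x + b) (1 : R) f df ->
  is_derive x (1 : R) (fun x => f (a * x + b)) (a * df).
Proof.
move=> dfx; have dg : is_derive x (1 : R) (fun x : R => a * x + b) a.
  have := is_deriveD (is_deriveZ a (is_derive_id x (1 : R)))
    (is_derive_cst b x (1 : R)).
  by rewrite addr0 /GRing.scale/= mulr1.
by rewrite mulrC; exact: (@is_derive1_comp _ f (fun x => a * x + b)).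
Qed.

Lemma smooth_affine f a b : smooth f -> smooth (fun x => f (a * x + b)).
Proof.
move=> sf.
(* [g] ranges over all smooth functions, because one differentiation replaces [f] by another smooth
   function, up to the factor [a]. *)
pose B h := exists2 g, smooth g & h = fun x => g (a * x + b).
apply: (@smooth_fspan B); last by exists f.
move=> _ [g sg ->]; exists (fun x => a * derive1 g (a * x + b)).
  apply: fspanZ; apply: fspan_base.
  exact: (ex_intro2 _ _ _ (smooth_derive1 sg) erefl).
by move=> x; apply: is_derive_affine; exact: smooth_is_derive.
Qed.

Lemma smoothM f g : smooth f -> smooth g -> smooth (fun x => f x * g x).
Proof.
move=> sf sg.
pose B h := exists f g, [/\ smooth f, smooth g & h = fun x => f x * g x].
apply: (@smooth_fspan B); last by exists f, g.
move=> {f sf g sg} _ [f [g [sf sg ->]]].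
exists (fun x => f x * derive1 g x + g x * derive1 f x).
  apply: fspanD; apply: fspan_base.
    by exists f, (derive1 g); split; [|exact: smooth_derive1|].
  by exists g, (derive1 f); split; [|exact: smooth_derive1|].
by move=> x; apply: is_deriveM; exact: smooth_is_derive.
Qed.

End smooth.

(** * A smooth compactly supported bump built from [expR (- x^-1)] *)

Section flat.
Context {R : realType}.

(** Differentiating [expR (- x^-1)] produces powers of [x^-1]; with these powers included,
    derivatives stay in the span of the family. *)
Definition flat (k : nat) (x : R) : R :=
  if 0 < x then x^-1 ^+ k * expR (- x^-1) else 0.

Lemma flat_ge0 k x : 0 <= flat k x.
Proof.
rewrite /flat; case: ifPn => // x0.
by rewrite mulr_ge0 ?expR_ge0// exprn_ge0// invr_ge0 ltW.
Qed.

(** This is the [m]-th power of [expR (- (t / m)) <= m / t], which follows from [1 + u <= expR u] at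
    [u = t / m]. *)
Lemma expRN_le (m : nat) (t : R) : 0 < t ->
  expR (- t) <= m%:R ^+ m * t^-1 ^+ m.
Proof.
move=> t0; case: m => [|m]; first by rewrite !expr0 mulr1 -expR0 ler_expR; lra.
have m0 : 0 < m.+1%:R :> R by [].
have -> : - t = m.+1%:R * - (t / m.+1%:R).
  by rewrite mulrN mulrCA divff ?mulr1// gt_eqF.
rewrite expRM_natl -exprMn lerXn2r ?nnegrE ?expR_ge0//.
  by rewrite mulr_ge0// invr_ge0 ltW.
rewrite expRN -[leRHS]invrK lef_pV2 ?posrE ?expR_gt0//; last first.
  by rewrite invr_gt0 mulr_gt0// invr_gt0.
by rewrite invfM invrK mulrC (le_trans _ (expR_ge1Dx _))// lerDr.
Qed.

(** Take [expRN_le] at [t = x^-1] with exponent [k + j]: the factor [x ^+ k] cancels the pole. The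
    case [j = 0] bounds [flat k], and [j = 1] gives its derivative at the origin. *)
Lemma flat_le k j x : 0 <= x -> flat k x <= (k + j)%:R ^+ (k + j) * x ^+ j.
Proof.
move=> x_ge0; rewrite /flat; case: ifPn => [x0|_]; last first.
  by rewrite mulr_ge0// exprn_ge0.
have xV0 : 0 < x^-1 by rewrite invr_gt0.
have /(ler_wpM2l (exprn_ge0 k (ltW xV0))) := @expRN_le (k + j) _ xV0.
move=> /le_trans; apply; rewrite invrK mulrCA ler_wpM2l ?exprn_ge0//.
by rewrite exprD mulrA -exprMn mulVf ?expr1n ?mul1r// gt_eqF.
Qed.

Lemma is_derive_flat k (x : R) :
  is_derive x (1 : R) (flat k) (flat k.+2 x + - k%:R * flat k.+1 x).
Proof.
have [x0|x0|->] := ltgtP x 0.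
- rewrite /flat !ltNge !ltW//= mulr0 addr0.
  apply: (@near_eq_is_derive _ _ _ (cst 0)).
  near=> y; rewrite /= ifF//; apply/negbTE; rewrite -leNgt ltW//.
  by near: y; exact: lt_nbhsl.
- rewrite /flat x0.
  pose f (y : R) := y^-1 ^+ k * expR (- y^-1).
  apply: (@near_eq_is_derive _ _ _ f).
    by near=> y; rewrite /= ifT//; near: y; exact: lt_nbhsr.
  have dV : is_derive x (1 : R) (fun y : R => y^-1) (- x ^- 2).
    apply: (is_derive_eq (is_deriveV _ (is_derive_id x (1 : R)))).
      by rewrite gt_eqF.
    by rewrite /= scaler1.
  have dE : is_derive x (1 : R) (fun y : R => expR (- y^-1))
      (expR (- x^-1) * x ^- 2).
    have dNV : is_derive x (1 : R) (fun y : R => - y^-1) (x ^- 2).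
      by rewrite -[x ^- 2]opprK; exact: is_deriveN.
    exact: (is_derive1_comp (is_derive_expR _) dNV).
  have -> : f = (fun y => y^-1) ^+ k * (fun y => expR (- y^-1)).
    by apply/funext => y; rewrite /f !fctE.
  apply: (is_derive_eq (is_deriveM (is_deriveX k dV) dE)).
  rewrite /= /GRing.scale/= !fctE -exprVn.
  by case: k {f} => [|k]; rewrite ?exprS; ring.
- rewrite /flat ltxx mulr0 addr0.
  suff fq : h^-1 *: (flat k (h *: 1 + 0) - flat k 0) @[h --> 0^'] --> (0 : R).
    by split; [apply/cvg_ex; exists 0|apply/cvg_lim].
  (* Dividing by [h] raises the exponent by one, so the difference quotient at 0 is again a member
     of the family. *)
  have flatE (h : R) : h^-1 *: (flat k (h *: 1 + 0) - flat k 0) = flat k.+1 h.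
    rewrite /GRing.scale/= mulr1 addr0 /flat ltxx subr0.
    by case: ifPn => h0; rewrite ?mulr0// mulrA -exprS.
  under eq_fun do rewrite flatE.
  apply: cvg_within_filter.
  (* The constant of [flat_le] for the exponent [k.+1] and [j = 1]. *)
  pose C : R := (k.+1 + 1)%:R ^+ (k.+1 + 1).
  apply: (@squeeze_cvgr _ _ _ _ (cst 0) (fun h => C * `|h|)).
  - near=> h; rewrite flat_ge0/=.
    have [h0|h0] := leP 0 h; first by rewrite -(expr1 `|h|) ger0_norm// flat_le.
    by rewrite /flat ifF ?mulr_ge0 ?exprn_ge0// ltNge ltW.
  - exact: cvg_cst.
  - rewrite -[X in _ --> X](mulr0 C); apply: cvgM; first exact: cvg_cst.
    by have := @norm_continuous _ R 0; rewrite /continuous_at normr0.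
Unshelve. all: by end_near. Qed.

Lemma smooth_flat k : smooth (flat k).
Proof.
pose B h := exists k, h = flat k.
apply: (@smooth_fspan _ B); last by exists k.
move=> {k} _ [k ->]; exists (fun x => flat k.+2 x + - k%:R * flat k.+1 x).
  apply: fspanD; first by apply: fspan_base; exists k.+2.
  by apply: fspanZ; apply: fspan_base; exists k.+1.
exact: is_derive_flat.
Qed.

Lemma flat_bound k x : `|flat k x| <= k%:R ^+ k.
Proof.
rewrite ger0_norm ?flat_ge0//; have [x0|x0] := leP 0 x.
  by have := flat_le k 0 x0; rewrite addn0 expr0 mulr1.
by rewrite /flat ifF ?exprn_ge0// ltNge ltW.
Qed.

(** The factors vanish for [x <= -1] and for [x >= 2]. This interval is deliberately not centred at
    0, so that the derivative at 0 does not vanish. The coefficients [1] and [-1] are explicit to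
    match [smooth_affine]. *)
Definition bump (x : R) : R := flat 0 (1 * x + 1) * flat 0 (-1 * x + 2).

Lemma smooth_bump : smooth bump.
Proof. by apply: smoothM; apply: smooth_affine; exact: smooth_flat. Qed.

Lemma bump_out x : 2 < `|x| -> bump x = 0.
Proof.
rewrite /bump /flat; case: ifPn => x1; case: ifPn => x2; rewrite ?mulr0 ?mul0r//.
by rewrite ltr_normr => /orP[]; lra.
Qed.

Lemma bump_bound x : `|bump x| <= 1.
Proof.
by rewrite normrM mulr_ile1// (le_trans (flat_bound _ _))// expr0.
Qed.

Lemma derive1_bump x : derive1 bump x =
  flat 2 (1 * x + 1) * flat 0 (-1 * x + 2) -
  flat 0 (1 * x + 1) * flat 2 (-1 * x + 2).
Proof.
have d a b : is_derive x (1 : R) (fun x => flat 0 (a * x + b))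
    (a * flat 2 (a * x + b)).
  apply: is_derive_affine; apply: (is_derive_eq (is_derive_flat 0 _)).
  by rewrite oppr0 mul0r addr0.
have [_ dbump] := is_deriveM (d 1 1) (d (-1) 2).
rewrite derive1E [LHS]dbump.
by rewrite /GRing.scale/=; ring.
Qed.

Lemma derive1_bump_bound x : `|derive1 bump x| <= 8.
Proof.
rewrite derive1_bump (le_trans (ler_normB _ _))// !normrM.
have H0 y := flat_bound 0 y; have H2 y := flat_bound 2 y.
have {}H2 y : `|flat 2 y| <= 4 by rewrite (le_trans (H2 y))//; lra.
(* [flat_bound] gives [2 ^+ 2 = 4] for [flat 2] and [0 ^+ 0 = 1] for [flat 0]. *)
have -> : 8 = 4 * 1 + 1 * 4 :> R by lra.
by apply: lerD; apply: ler_pM => //; rewrite ?H2// (le_trans (H0 _)) ?expr0.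
Qed.

Lemma derive1_bump0 : derive1 bump 0 != 0.
Proof.
rewrite derive1_bump /flat !mulr0 !add0r !ltr01 !ltr0n /= !expr0 !invr1 !mul1r.
rewrite expr1n mul1r.
(* The factors are evaluated at 1 and 2, and [flat 2] differs from [flat 0] there by the weights 1
   and 1/4. *)
rewrite (_ : _ - _ = (1 - 2^-1 ^+ 2) * (expR (- 1) * expR (- 2^-1))); last ring.
by rewrite gt_eqF// !mulr_gt0 ?expR_gt0//; lra.
Qed.

End flat.

(** * Change of variables [x = l * y] in Lebesgue integrals *)

Section dilation.
Context {R : realType}.
Local Notation mu := (@lebesgue_measure R).
Variables (l : R) (l0 : 0 < l).

Let ml : measurable_fun [set: measurableTypeR R]
  (fun x => l * x : measurableTypeR R).
Proof. by apply: continuous_measurable_fun; exact: mulrl_continuous. Qed.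

Let lpos : {nonneg R} := NngNum (ltW l0).
Let scale_l (x : measurableTypeR R) : measurableTypeR R := l * x.

(** By uniqueness of Lebesgue measure, it suffices to compare lengths of half-open intervals. The
    pushforward is packaged as a measure [nu] so that [mscale] applies to it. *)
Lemma lebesgue_measure_dilation :
  exists nu : {measure set (measurableTypeR R) -> \bar R},
    (forall A, nu A = pushforward mu scale_l A) /\
    forall A : set R, measurable A -> mu A = mscale lpos nu A.
Proof.
have [nu nuE] : exists nu : {measure set (measurableTypeR R) -> \bar R},
    forall A, nu A = pushforward mu scale_l A.
  by unshelve (eexists => A; reflexivity).
exists nu; split => //.
apply: lebesgue_measure_unique => _ [[a b] _ <-].
change (mu `]a, b]%classic = l%:E * nu `]a, b]%classic)%E.
rewrite nuE /pushforward.
have -> : scale_l @^-1` `]a, b]%classic = `]a / l, b / l]%classic.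
  apply/seteqP; split => x /=; rewrite !in_itv/=;
    by rewrite ltr_pdivrMr// ler_pdivlMr// ![x * l]mulrC.
rewrite !lebesgue_measure_itv/= !lte_fin ltr_pM2r ?invr_gt0//.
case: ifPn => ab; last by rewrite mule0.
by rewrite -!EFinB -EFinM -mulrBl mulrCA divff ?mulr1// gt_eqF.
Qed.

Lemma ge0_integral_dilation (f : R -> \bar R) : measurable_fun setT f ->
  (forall x, 0 <= f x)%E ->
  (\int[mu]_x f x = l%:E * \int[mu]_x f (l * x)%R)%E.
Proof.
move=> mf f0.
have [nu [nuE munu]] := lebesgue_measure_dilation.
rewrite (@eq_measure_integral _ _ _ _ (mscale lpos nu)); last first.
  by move=> A mA _; exact: munu.
rewrite ge0_integral_mscale//.
rewrite (@eq_measure_integral _ _ _ _ (pushforward mu scale_l)); last first.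
  by move=> A _ _; exact: nuE.
by rewrite (@ge0_integral_pushforward _ _ _ _ _ _ ml).
Qed.

(** Positive and negative parts are handled separately. The factor [l] stays under the integral,
    since it is moved across only for nonnegative integrands. *)
Lemma integral_dilation (f : R -> \bar R) : measurable_fun setT f ->
  (\int[mu]_x f x = \int[mu]_x (l%:E * f (l * x)%R))%E.
Proof.
move=> mf; rewrite [LHS]integralE [RHS]integralE.
rewrite (ge0_integral_dilation (measurable_funepos mf))//.
rewrite (ge0_integral_dilation (measurable_funeneg mf))//.
rewrite ge0_funeposM ?ge0_funenegM ?(ltW l0)//.
rewrite -!ge0_integralZl ?lee_fin ?(ltW l0)//=.
- congr (_ - _)%E; apply: eq_integral => x _; congr (_ * _)%E.
    by rewrite !funeposE.
  by rewrite !funenegE.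
- exact: (measurableT_comp (measurable_funeneg mf) ml).
- exact: (measurableT_comp (measurable_funepos mf) ml).
Qed.

End dilation.

(** * Weak derivatives under dilation *)

Section weak_deriv_dilation.
Context {R : realType}.
Local Notation mu := (@lebesgue_measure R).
Implicit Types (f g phi psi : R -> R) (c l x : R).

Lemma measurable_dilation f l : measurable_fun setT f ->
  measurable_fun setT (fun x => f (l * x)).
Proof.
move=> mf; apply: (measurableT_comp mf).
by apply: continuous_measurable_fun; exact: mulrl_continuous.
Qed.

Lemma derive1_dilation phi l x : smooth phi ->
  derive1 (fun x => phi (l * x)) x = l * derive1 phi (l * x).
Proof.
move=> sphi.
have -> : (fun x => phi (l * x)) = (fun x => phi (l * x + 0)).
  by apply/funext => y; rewrite addr0.
have dphi (y : R) : is_derive y (1 : R) (fun x => phi (l * x + 0))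
    (l * derive1 phi (l * y + 0)).
  by apply: is_derive_affine; exact: smooth_is_derive.
by rewrite (derive1_is_derive dphi) addr0.
Qed.

Lemma test_fun_dilation phi l : 0 < l -> test_fun phi ->
  test_fun (fun x => phi (l * x)).
Proof.
move=> l0 [sphi [M phiM]]; split.
  have -> : (fun x => phi (l * x)) = (fun x => phi (l * x + 0)).
    by apply/funext => y; rewrite addr0.
  exact: smooth_affine.
exists (M / l) => x; rewrite ltr_pdivrMr// => Mx.
by apply: phiM; rewrite normrM (gtr0_norm l0) mulrC.
Qed.

Lemma locally_integrableZ f c : locally_integrable setT f ->
  locally_integrable setT (fun x => c * f x).
Proof.
move=> [mf oT fK]; split => // [|K _ cK].
  by apply: measurable_funM => //; exact: measurable_cst.
under eq_integral do rewrite normrM EFinM.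
rewrite ge0_integralZl//.
- by rewrite lte_mul_pinfty// fK.
- exact: compact_measurable.
- by apply: measurable_funTS; do 2 apply: measurableT_comp => //.
Qed.

Lemma locally_integrable_dilation f l : 0 < l -> locally_integrable setT f ->
  locally_integrable setT (fun x => f (l * x)).
Proof.
move=> l0 [mf oT fK]; split => // [|K _ cK]; first exact: measurable_dilation.
pose lK := (fun x => l * x) @` K.
have clK : compact lK.
  apply: continuous_compact => //; apply: continuous_subspaceT.
  exact: mulrl_continuous.
(* Extension by zero outside the compact image of [K] turns the integral over [K] into one over the
   line, where the change of variables applies. *)
pose F := (fun x => `|f x|%:E) \_ lK.
have F0 x : (0 <= F x)%E by apply: erestrict_ge0 => *; rewrite lee_fin.
have mF : measurable_fun setT F.
  apply/(measurable_restrictT _ (compact_measurable clK)).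
  by apply: measurable_funTS; do 2 apply: measurableT_comp => //.
have := fK lK (@subsetT _ _) clK.
rewrite integral_mkcond (ge0_integral_dilation l0 mF F0).
have FE : (fun x => F (l * x)) = (fun x => `|f (l * x)|%:E) \_ K.
  apply/funext => x; rewrite /F /patch; congr (if _ then _ else _).
  apply/idP/idP => /set_mem.
    move=> [y Ky /(mulfI (lt0r_neq0 l0)) <-]; exact: mem_set.
  by move=> Kx; apply/mem_set; exists x.
rewrite FE -integral_mkcond.
(* A finite product with [l > 0] forces the integral itself to be finite. *)
case: (integral _ _ _) => [r _| |//]; first exact: ltry.
by rewrite gt0_muley// lte_fin.
Qed.

Lemma weak_deriv_dilation psi g l : 0 < l -> weak_deriv psi g ->
  weak_deriv (fun x => psi (l^-1 * x)) (fun x => l^-1 * g (l^-1 * x)).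
Proof.
move=> l0 [psiL [gL psig]]; have lV0 : 0 < l^-1 by rewrite invr_gt0.
have lN0 : l != 0 by rewrite gt_eqF.
have lK (y : R) : l^-1 * (l * y) = y by rewrite mulKf.
have [mpsi _ _] := psiL; have [mg _ _] := gL.
split; first exact: locally_integrable_dilation.
split; first by apply: locally_integrableZ; exact: locally_integrable_dilation.
move=> phi tphi; have [sphi _] := tphi.
have mphi := continuous_measurable_fun (smooth_continuous sphi).
have mphi' :=
  continuous_measurable_fun (smooth_continuous (smooth_derive1 sphi)).
rewrite (integral_dilation l0); last first.
  by apply/measurable_EFinP/measurable_funM => //; exact: measurable_dilation.
rewrite [in RHS](integral_dilation l0); last first.
  apply/measurable_EFinP/measurable_funM => //; apply: measurable_funM => //.
  exact: measurable_dilation.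
(* After substituting [x = l * y], the identity is that of [psi] tested with [phi (l * y)]. On the
   left the Jacobian [l] is the chain-rule factor; on the right it cancels [l^-1]. *)
have := psig _ (test_fun_dilation l0 tphi).
congr (_ = - _)%E; apply: eq_integral => x _; rewrite -EFinM.
  by rewrite derive1_dilation// lK mulrCA.
by rewrite lK -(mulrA l^-1) (mulVKf lN0).
Qed.

End weak_deriv_dilation.

(** * Scaling of the energy, and functions with arbitrarily small kinetic energy *)

Section minimizers.
Context {R : realType}.
Local Notation mu := (@lebesgue_measure R).
Implicit Types (c f g phi psi z : R -> R) (l w x : R).

(** Extended by zero to [x <= 0], the nonnegative [z] is lower semi-continuous on the whole line,
    hence measurable; multiplying by [x] gives [cz z]. *)
Lemma measurable_cz z : (forall x, 0 < x -> 0 <= z x) -> lsc_pos z ->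
  measurable_fun setT (cz z).
Proof.
move=> z0 lscz; pose e x := if 0 < x then z x else 0.
have me : measurable_fun setT e.
  apply/measurable_EFinP; apply: lower_semicontinuous_measurable => x a.
  rewrite lte_fin => aex.
  have [a0|a0] := ltP a 0.
    exists setT; first exact: filterT.
    move=> y _; rewrite lte_fin (lt_le_trans a0)// /e.
    by case: ifPn => // /z0.
  move: aex; rewrite /e; case: ifPn => [x0 axz|_]; last by rewrite ltNge a0.
  exists [set y | 0 < y /\ a < z y].
    near=> y; split; first by near: y; exact: lt_nbhsr.
    by near: y; exact: lscz.
  by move=> y [y0 ay]; rewrite lte_fin y0.
have -> : cz z = (fun x => e x * x).
  by apply/funext => x; rewrite /cz /e; case: ifPn; rewrite ?mul0r.
exact: measurable_funM.
Unshelve. all: by end_near. Qed.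

Lemma cz_ge0 z x : (forall x, 0 < x -> 0 <= z x) -> 0 <= cz z x.
Proof.
by move=> z0; rewrite /cz; case: ifPn => // x0; rewrite mulr_ge0 ?z0// ltW.
Qed.

Lemma admissible_dilation w psi l : 0 < l -> admissible w psi ->
  admissible (l * w) (fun x => psi (l^-1 * x)).
Proof.
move=> l0 [mpsi [psi0 psiw]]; have mpsil := measurable_dilation l^-1 mpsi.
split => //; split => //.
rewrite (ge0_integral_dilation l0); last 2 first.
- exact/measurable_EFinP.
- by move=> x; rewrite lee_fin.
have lK (y : R) : l^-1 * (l * y) = y by rewrite mulKf// gt_eqF.
by under eq_integral do rewrite lK; rewrite psiw.
Qed.

(** Only an upper bound is claimed: the dilated [g] is one candidate in the infimum defining
    [energy]. Squaring it yields [l^-1 ^+ 2], and the Jacobian [l] leaves [l^-1]. *)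
Lemma energy_dilation c psi g l : 0 < l ->
  measurable_fun setT c -> (forall x, 0 <= c x) -> weak_deriv psi g ->
  (energy c (fun x => psi (l^-1 * x)%R) <=
   (l^-1)%:E * \int[mu]_x (g x ^+ 2 / 2)%:E + l%:E * \int[mu]_x (c `|psi x|)%:E)%E.
Proof.
move=> l0 mc c0 wpsi.
have [[mpsi _ _] [[mg _ _] _]] := wpsi.
have lK (y : R) : l^-1 * (l * y) = y by rewrite mulKf// gt_eqF.
have mcpsi : measurable_fun setT (fun x => c `|psi x|).
  by apply: measurableT_comp => //; exact: measurableT_comp.
have mg2 : measurable_fun setT (fun x => g x ^+ 2 / 2).
  by apply: measurable_funM => //; exact: measurable_funX.
have g20 x : 0 <= g x ^+ 2 / 2 by rewrite divr_ge0// sqr_ge0.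
apply: ereal_inf_lbound.
exists (fun x => l^-1 * g (l^-1 * x)); first exact: weak_deriv_dilation.
rewrite (ge0_integral_dilation l0); last 2 first.
- apply/measurable_EFinP/measurable_funD; last first.
    exact: (measurable_dilation _ mcpsi).
  apply: measurable_funM => //; apply: measurable_funX.
  by apply: measurable_funM => //; exact: measurable_dilation.
- by move=> x; rewrite lee_fin addr_ge0// divr_ge0// sqr_ge0.
transitivity (l%:E * \int[mu]_x
    ((l^-1 ^+ 2)%:E * (g x ^+ 2 / 2)%:E + (c `|psi x|)%:E))%E.
  congr (_ * _)%E; apply: eq_integral => x _.
  by rewrite !lK -EFinM -EFinD exprMn -mulrA.
rewrite ge0_integralD//; last 4 first.
- by move=> x _; rewrite -EFinM lee_fin mulr_ge0// sqr_ge0.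
- by apply: measurable_funeM; exact/measurable_EFinP.
- by move=> x _; rewrite lee_fin.
- exact/measurable_EFinP.
rewrite ge0_integralZl ?lee_fin ?sqr_ge0//; last 2 first.
- exact/measurable_EFinP.
- by move=> x _; rewrite lee_fin.
rewrite ge0_muleDr; last 2 first.
- by rewrite mule_ge0 ?lee_fin ?sqr_ge0// integral_ge0// => x _; rewrite lee_fin.
- by rewrite integral_ge0// => x _; rewrite lee_fin.
congr (_ + _)%E; rewrite muleA -EFinM; congr (_%:E * _)%E.
by rewrite expr2 mulrA divff ?mul1r// gt_eqF.
Qed.

(** As [energy] is an infimum, [g] may depend on [delta]; this avoids uniqueness of weak
    derivatives. The integral of [g * phi] is made small by Young's inequality on the bounded
    support of [phi]. *)
Lemma weak_deriv_small psi phi (M : R) :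
  (forall delta : R, 0 < delta ->
    exists2 g, weak_deriv psi g & (\int[mu]_x (g x ^+ 2 / 2)%:E <= delta%:E)%E) ->
  test_fun phi -> (forall x, `|phi x| <= 1) -> 0 <= M ->
  (forall x, M < `|x| -> phi x = 0) ->
  (\int[mu]_x (psi x * derive1 phi x)%:E = 0)%E.
Proof.
move=> small tphi phi1 M0 phiM.
apply/eqP; rewrite -abse_eq0; apply/eqP/le_anti; rewrite abse_ge0 andbT.
apply/lee_addgt0Pr => e e0; rewrite add0e.
have M1 : 0 < 1 + M by lra.
(* With kinetic energy at most [eta ^+ 2], the final bound is [eta^-1 * eta ^+ 2 + eta / 2 * (2 * M)
   = eta * (1 + M)]. *)
have [eta [eta0 etaE]] : exists eta, 0 < eta /\ eta * (1 + M) = e.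
  by exists (e / (1 + M)); rewrite divr_gt0// divfK// gt_eqF.
have etaV : 0 <= eta^-1 by rewrite invr_ge0 ltW.
have eta2 : 0 <= eta / 2 by rewrite divr_ge0// ltW.
have [|g wg gsmall] := small (eta ^+ 2); first by rewrite exprn_gt0.
have [mpsi [[mg _ _] psig]] := wg.
have mphi := continuous_measurable_fun (smooth_continuous tphi.1).
have mg2 : measurable_fun setT (fun x => g x ^+ 2 / 2).
  by apply: measurable_funM => //; exact: measurable_funX.
rewrite psig// abseN.
have mgphi : measurable_fun setT (fun x => (g x * phi x)%:E).
  exact/measurable_EFinP/measurable_funM.
rewrite (le_trans (le_abse_integral _ _ _))//.
pose I : set R := `[- M, M]%classic.
have mI : measurable I by exact: measurable_itv.
have muI : mu I = (2 * M)%:E.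
  rewrite /I lebesgue_measure_itv/= lte_fin; case: ifPn => [_|].
    by rewrite -EFinB; congr _%:E; ring.
  (* The degenerate interval occurs only for [M = 0], where both sides vanish. *)
  by rewrite -leNgt => MM; congr _%:E; lra.
have : (\int[mu]_x `|(g x * phi x)%:E| <=
    \int[mu]_x ((eta^-1)%:E * (g x ^+ 2 / 2)%:E + (eta / 2)%:E * (\1_I x)%:E))%E.
  apply: ge0_le_integral => //.
  - exact: measurableT_comp.
  - by apply: emeasurable_funD; apply: measurable_funeM; exact/measurable_EFinP.
  move=> x _; rewrite abse_EFin -!EFinM -EFinD lee_fin.
  have young (y : R) : y <= eta^-1 * (y ^+ 2 / 2) + eta / 2.
    rewrite -subr_ge0.
    have -> : eta^-1 * (y ^+ 2 / 2) + eta / 2 - y = eta^-1 / 2 * (y - eta) ^+ 2.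
      by field; rewrite gt_eqF.
    by rewrite mulr_ge0 ?sqr_ge0// divr_ge0// invr_ge0 ltW.
  have [Ix|Ix] := boolP (x \in I).
    rewrite indicE Ix mulr1 normrM.
    rewrite (le_trans (ler_piMr _ (phi1 x)))//.
    by rewrite -(real_normK (num_real (g x))) young.
  have -> : phi x = 0.
    apply: phiM; rewrite ltNge; apply: contra Ix => xM.
    by apply/mem_set; rewrite /I/= in_itv/= -ler_norml.
  by rewrite mulr0 normr0 addr_ge0// mulr_ge0// divr_ge0 ?sqr_ge0.
move=> /le_trans; apply.
rewrite ge0_integralD//; last 4 first.
- by move=> x _; rewrite -EFinM lee_fin mulr_ge0// divr_ge0 ?sqr_ge0.
- by apply: measurable_funeM; exact/measurable_EFinP.
- by move=> x _; rewrite -EFinM lee_fin mulr_ge0.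
- by apply: measurable_funeM; exact/measurable_EFinP.
rewrite ge0_integralZl ?lee_fin//; last 2 first.
- exact/measurable_EFinP.
- by move=> x _; rewrite lee_fin divr_ge0 ?sqr_ge0.
rewrite ge0_integralZl ?lee_fin//; last first.
- exact/measurable_EFinP.
rewrite integral_indic// setIT [X in (_ + _ * X)%E]muI.
rewrite (@le_trans _ _
  ((eta^-1)%:E * (eta ^+ 2)%:E + (eta / 2)%:E * (2 * M)%:E)%E)//.
  by rewrite leeD2r// lee_pmul2l// lte_fin invr_gt0.
rewrite -!EFinM -EFinD lee_fin -etaE le_eqVlt; apply/orP; left; apply/eqP.
by field; rewrite gt_eqF.
Qed.

Lemma weak_deriv_small_integral0 psi w : admissible w psi ->
  (forall delta : R, 0 < delta ->
    exists2 g, weak_deriv psi g & (\int[mu]_x (g x ^+ 2 / 2)%:E <= delta%:E)%E) ->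
  w = 0.
Proof.
move=> [mpsi [psi0 psiw]] small.
have ipsi : mu.-integrable setT (EFin \o psi).
  apply/integrableP; split; first exact/measurable_EFinP.
  under eq_integral do rewrite /= ger0_norm//.
  by rewrite psiw ltry.
pose d := derive1 (@bump R).
have cd : continuous d := smooth_continuous (smooth_derive1 smooth_bump).
have md : measurable_fun setT d := continuous_measurable_fun cd.
(* The chain-rule factor [n.+1%:R^-1] is left out: with it the integrands would tend to 0 and the
   limit would carry no information. *)
pose f_ (n : nat) x : \bar R := (psi x * d (n.+1%:R^-1 * x))%:E.
have mf_ n : measurable_fun setT (f_ n).
  by apply/measurable_EFinP/measurable_funM => //; exact: measurable_dilation.
have f_le n x : (`|f_ n x| <= (8 * psi x)%:E)%E.
  rewrite /f_ abse_EFin lee_fin normrM (ger0_norm (psi0 x)) mulrC.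
  by rewrite ler_wpM2r// derive1_bump_bound.
have i8psi : mu.-integrable setT (fun x => (8 * psi x)%:E).
  exact: (integrableZl measurableT 8 ipsi).
have if_ n : mu.-integrable setT (f_ n).
  apply: le_integrable i8psi; [exact: measurableT|exact: mf_|move=> x _].
  by rewrite (le_trans (f_le n x))// lee_fin ler_norm.
have f_0 n : (\int[mu]_x f_ n x = 0)%E.
  have n0 : 0 < n.+1%:R^-1 :> R by rewrite invr_gt0.
  have tn : test_fun (fun x => bump (n.+1%:R^-1 * x)).
    apply: test_fun_dilation => //; split; first exact: smooth_bump.
    by exists 2; exact: bump_out.
  pose phi x := bump (n.+1%:R^-1 * x).
  have : (\int[mu]_x (psi x * derive1 phi x)%:E = 0)%E.
    apply: (@weak_deriv_small _ _ (2 * n.+1%:R)) => //.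
    - by move=> x; exact: bump_bound.
    - move=> x nx; apply: bump_out.
      by rewrite normrM gtr0_norm// mulrC ltr_pdivlMr.
  have -> : (\int[mu]_x (psi x * derive1 phi x)%:E =
      \int[mu]_x ((n.+1%:R^-1)%:E * f_ n x))%E.
    apply: eq_integral => x _; rewrite (derive1_dilation _ _ smooth_bump) -EFinM.
    by congr _%:E; rewrite mulrCA.
  rewrite [X in X = _ -> _](integralZl measurableT (if_ n)).
  by move/eqP; rewrite mule_eq0 eqe gt_eqF//= => /eqP.
(* Each [f_ n] has integral 0 and is dominated by [8 * psi]; pointwise the limit is [psi x * d 0],
   with integral [d 0 * w]. *)
have [] := @dominated_convergence _ _ _ mu setT measurableT f_
  (fun x => (psi x * d 0)%:E) (fun x => (8 * psi x)%:E) mf_.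
- by apply/measurable_EFinP/measurable_funM.
- apply: aeW => x _; apply: cvg_EFin; first by apply: nearW.
  apply: cvgM; first exact: cvg_cst.
  apply: continuous_cvg; first exact: cd.
  rewrite -[X in _ --> X](mul0r x); apply: cvgM; last exact: cvg_cst.
  exact: cvg_harmonic.
- exact: i8psi.
- by apply: aeW => x n _; exact: f_le.
move=> _ _; under eq_fun do rewrite f_0.
move=> /(cvg_unique _ (cvg_cst _)) => /(_ (@ereal_hausdorff _)).
under eq_integral do rewrite mulrC EFinM.
rewrite integralZl// psiw -EFinM => /esym/eqP.
by rewrite eqe mulf_eq0 (negbTE derive1_bump0)/= => /eqP.
Qed.

End minimizers.

(** * Comparison of a minimizer with its dilation of mass [W] *)

Theorem mainTheorem10 (R : realType) (z : R -> R) (W d : R) :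
  (forall x, 0 < x -> 0 <= z x) ->
  (forall x y, 0 < x -> x <= y -> z y <= z x) ->
  lsc_pos z ->
  (\int[@lebesgue_measure R]_(x in `[0%R, 1%R]) (Num.sqrt (cz z x))%:E < +oo)%E ->
  0 < W ->
  (fun h => (fine (tau z h) - fine (tau z 0)) / h) @ 0^'+ --> d ->
  (forall w, 0 <= w <= W -> tau z w = (d * w)%:E) ->
  forall w, 0 < w < W ->
    ~ exists psi : R -> R, admissible w psi /\ energy (cz z) psi = tau z w.
Proof.
move=> z0 _ lscz _ W0 _ tauE w /andP[w0 wW] [psi [apsi minpsi]].
suff : w = 0 by move=> wE; rewrite wE ltxx in w0.
apply: (weak_deriv_small_integral0 apsi) => delta delta0.
have mc := measurable_cz z0 lscz; have c0 x : 0 <= cz z x by exact: cz_ge0.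
pose l := W / w.
have l1 : 1 < l by rewrite /l ltr_pdivlMr// mul1r.
have l0 : 0 < l by exact: lt_trans l1.
have lw : l * w = W by rewrite divfK// gt_eqF.
have l2 : 0 < l ^+ 2 - 1 by rewrite subr_gt0 exprn_egt1.
(* The infimum over weak derivatives need not be attained, so [g] is chosen with slack [eps], tuned
   so that [l ^+ 2 * eps = delta * (l ^+ 2 - 1)]. *)
pose eps := delta * (l ^+ 2 - 1) / l ^+ 2.
have eps0 : 0 < eps by rewrite !mulr_gt0// invr_gt0 exprn_gt0.
have : (energy (cz z) psi < (d * w + eps)%:E)%E.
  by rewrite minpsi tauE ?(ltW w0) ?(ltW wW)// lte_fin ltrDl.
move=> /ereal_inf_lt[_ [g wg <-]].
have : (tau z W <= energy (cz z) (fun x => psi (l^-1 * x)%R))%E.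
  apply: ereal_inf_lbound; exists (fun x => psi (l^-1 * x)) => //.
  by rewrite -lw; exact: admissible_dilation.
rewrite tauE ?lexx ?(ltW W0)// => tauW.
have := le_trans tauW (energy_dilation l0 mc c0 wg).
have [[mpsi _ _] [[mg _ _] _]] := wg.
have mcpsi : measurable_fun setT (fun x => cz z `|psi x|).
  by apply: measurableT_comp => //; exact: measurableT_comp.
have mg2 : measurable_fun setT (fun x => g x ^+ 2 / 2).
  by apply: measurable_funM => //; exact: measurable_funX.
have g20 x : 0 <= g x ^+ 2 / 2 by rewrite divr_ge0// sqr_ge0.
have A0 : (0 <= \int[@lebesgue_measure R]_x (g x ^+ 2 / 2)%:E)%E.
  by apply: integral_ge0 => x _; rewrite lee_fin.
have B0 : (0 <= \int[@lebesgue_measure R]_x (cz z `|psi x|)%:E)%E.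
  by apply: integral_ge0 => x _; rewrite lee_fin.
under [X in _ -> (X < _)%E -> _]eq_integral do rewrite EFinD.
rewrite ge0_integralD//; last 4 first.
- by move=> x _; rewrite lee_fin.
- exact/measurable_EFinP.
- by move=> x _; rewrite lee_fin.
- exact/measurable_EFinP.
move=> lower upper; exists g => //; move: A0 B0 lower upper.
(* Here [a] is the kinetic and [b] the potential part; infinite values contradict nonnegativity or
   the upper bound. *)
move: (integral _ _ _) (integral _ _ _) => [b| |] [a| |] //.
rewrite -!EFinM -!EFinD !lee_fin lte_fin => a0 b0 lower upper.
(* Minimality at mass [W = l * w] gives [l ^+ 2 * (d * w) <= a + l ^+ 2 * b]. Subtracting this from
   [l ^+ 2] times the upper bound for [a + b] eliminates [b]. *)
have key : (l ^+ 2 - 1) * a <= (l ^+ 2 - 1) * delta.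
  have lVl : l * (l^-1 * a + l * b) = a + l ^+ 2 * b.
    by field; rewrite gt_eqF.
  have epsE : l ^+ 2 * eps = delta * (l ^+ 2 - 1).
    by rewrite /eps; field; rewrite gt_eqF.
  have : l * (d * W) <= a + l ^+ 2 * b by rewrite -lVl ler_pM2l.
  have : l ^+ 2 * (a + b) <= l ^+ 2 * (d * w + eps).
    by rewrite ler_pM2l ?ltW// exprn_gt0.
  rewrite mulrDr [X in _ <= X]mulrDr epsE -lw.
  have -> : l * (d * (l * w)) = l ^+ 2 * (d * w) by ring.
  by move: (l ^+ 2 * (d * w)) => r; lra.
by move: key; rewrite ler_pM2l.
Qed.
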